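(* Let $\mathbb{P}$ be the set of all prime numbers, let $m\in\mathbb{N}$, and let $\mathcal{C}(m,\mathbb{P})\neq\emptyset$ and $\mathcal{C}(m+t,\mathbb{P})\neq\emptyset$ for some integer $t\geq 4$. Suppose that there exists an axis $\mathbb{L}_{[x],[y]}$ of $\mathcal{C}(m+t,\mathbb{N})$ (that is, $x,y\in\mathbb{N}$ with $x+y=m+t$) with $x\in\mathbb{P}$ and $x<y$ such that $$y>w>m-x,\qquad\text{where } w=\max\{u\in\Vert\mathcal{C}(m,\mathbb{N})\Vert \mid u\in\mathbb{P}\}.$$ Then there exists a generator $s\in\mathbb{N}$ with $m<s<m+t$ such that $\mathcal{C}(s,\mathbb{P})\neq\emptyset$.
   Context: $\mathbb{N}=\{1,2,3,\dots\}$. For $n\in\mathbb{N}$ and $\mathbb{M}\subseteq\mathbb{N}$, the circle of partition with generator $n$ and base set $\mathbb{M}$ is $\mathcal{C}(n,\mathbb{M})=\{[x]\mid x\in\mathbb{M},\ n-x\in\mathbb{M}\}$. The weight of a point $[x]$ is $\Vert[x]\Vert:=x$, and $\Vert\mathcal{C}(n,\mathbb{M})\Vert=\{x\mid [x]\in\mathcal{C}(n,\mathbb{M})\}$ is the set of weights; in particular $\Vert\mathcal{C}(n,\mathbb{N})\Vert=\{1,2,\dots,n-1\}$. An axis $\mathbb{L}_{[x],[y]}$ of $\mathcal{C}(n,\mathbb{M})$ is a pair of points $[x],[y]\in\mathcal{C}(n,\mathbb{M})$ with $x+y=n$. *)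

(* Defs.v *)
From mathcomp Require Import all_boot all_order all_algebra.
From mathcomp Require Import classical_sets.

Set Implicit Arguments.
Unset Strict Implicit.
Unset Printing Implicit Defensive.

Local Open Scope classical_set_scope.

Definition posnats : set nat := [set n | 0 < n].

Definition prime_set : set nat := [set p | prime p].

(* [CPoint x] is the point written [x]; its weight is x. *)
Record cpoint : Type := CPoint { weight : nat }.

(* Subtraction on nat is truncated; the conjunct [weight p <= n] makes
   [n - weight p] the true difference for any base set. *)
Definition circle (n : nat) (M : set nat) : set cpoint :=
  [set p | [/\ M (weight p), weight p <= n & M (n - weight p)]].

Definition weights (A : set cpoint) : set nat := weight @` A.

Definition is_axis (n : nat) (M : set nat) (p q : cpoint) : Prop :=
  [/\ circle n M p, circle n M q & weight p + weight q = n].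

Definition is_max (A : set nat) (w : nat) : Prop :=
  A w /\ forall u, A u -> u <= w.

(* Main.v *)
Require Import Defs.
From mathcomp Require Import all_boot all_order all_algebra.
From mathcomp Require Import classical_sets.

(** The generator is [s = w + x], where [x] is the prime endpoint of the given
    axis: both summands are prime, so [x] is a point of the circle, and the
    hypothesis [m - x < w < y] says, after adding [x], that
    [m < w + x < x + y = m + t]. *)

Local Open Scope classical_set_scope.

Theorem proposition3p2 (m t w : nat)
  (hm : posnats m)
  (ht : 4 <= t)
  (hCm : circle m prime_set !=set0)
  (hCmt : circle (m + t) prime_set !=set0)
  (hw : is_max (weights (circle m posnats) `&` prime_set) w)
  (hL : exists x y : nat,
     [/\ is_axis (m + t) posnats (CPoint x) (CPoint y),
         prime_set x,
         x < y,
         w < y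
       & (m%:Z - x%:Z < w%:Z)%R]) :
  exists s : nat, [/\ posnats s, m < s, s < m + t & circle s prime_set !=set0].
Proof.
case: hw => -[_ w_prime] _.
case: hL => x [y [[_ _ /= xy_sum] x_prime _ lt_wy]].
rewrite Num.Theory.ltrBlDr -PoszD ltz_nat => lt_m_wx.
exists (w + x); split=> //.
- exact: leq_ltn_trans (leq0n m) lt_m_wx.
- by rewrite -xy_sum addnC ltn_add2l.
- by exists (CPoint x); split; rewrite /= ?leq_addl ?addnK.
Qed.
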